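(* Let $(G_x \mid x \geq 0)$ be a coclass family of finite $p$-groups. Then there exists $x_0 \in \mathbb{N}$ such that the Quillen categories $\mathcal{A}_p(G_x)$ and $\mathcal{A}_p(G_y)$ are equivalent for all $x, y \geq x_0$.
   Context: Cohomology conventions: for a group $G$ acting on the right on an additively written abelian group $M$ (action $m \mapsto m^g$), $Z^n(G,M)$, $B^n(G,M)$, $H^n(G,M)$ denote normalised cocycles, coboundaries and cohomology. For $\tau \in Z^2(G,M)$, $\mathrm{Ext}(\tau)$ is the set $G \times M$ with multiplication $(g,m)(h,n) = (gh, m^h + n + \tau(g,h))$; it is an extension of $G$ by $M \cong \{(1,m)\}$. Setting: $p$ is a prime, $S$ is an infinite pro-$p$-group of finite coclass, and $T = \gamma_\ell(S)$ (a term of the lower central series, $\ell$ large enough) is a translation subgroup: $T \cong \mathbb{Z}_p^d$ ($\mathbb{Z}_p$ the $p$-adic integers), $P := S/T$ is a finite $p$-group, and the series $T_0 = T$, $T_{i+1} = [T_i, S]$ has $[T_i : T_{i+1}] = p$ for all $i$. Write $|P| = p^m$; $T$ is written additively and is a $P$-module via conjugation. Identify $S$ with $\mathrm{Ext}(\rho)$ for some $\rho \in Z^2(P,T)$. Coclass families: put $e = 3m$ and $M_x = T/p^{x+e}T$ for $x \in \mathbb{N}_0$. Let $pro_x : Z^2(P,T) \to Z^2(P,M_x)$ be induced by projection, $I^2(P,M_x)$ its image, and $J^2(P,M_x)$ the image of the map $Z^2(P, p^{x+e-m}T/p^{x+e}T) \to Z^2(P,M_x)$ induced by inclusion. For each $x$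 fix a complement $K^2(P,M_x)$ to $I^2(P,M_x)$ in $Z^2(P,M_x)$ contained in $J^2(P,M_x)$, chosen such that $mul(K^2(P,M_x)) = K^2(P,M_{x+1})$, where $mul$ is induced by $t + p^{x+e}T \mapsto pt + p^{x+e+1}T$ (such choices exist). The composite of the quotient map $Z^2(P,M_x) \to H^2(P,M_x)$, the connecting homomorphism $H^2(P,M_x) \to H^3(P,p^{x+e}T)$ of $0 \to p^{x+e}T \to T \to M_x \to 0$, and the isomorphism $H^3(P,p^{x+e}T) \to H^3(P,T)$ induced by division by $p^{x+e}$, restricts to an isomorphism $K^2(P,M_x) \to H^3(P,T)$. For $\eta \in H^3(P,T)$ let $\eta_x \in K^2(P,M_x)$ be the preimage of $\eta$, let $\rho_x = pro_x(\rho)$, and let $G_x = \mathrm{Ext}(\rho_x + \eta_x)$. The family $(G_x \mid x \in \mathbb{N}_0)$ is the coclass family defined by $\eta$; a coclass family is any family arising in this way. The Quillen category $\mathcal{A}_p(G)$ of a group $G$ has as objects the elementary abelian $p$-subgroups of $G$ and as morphisms $E \to F$ the injective homomorphisms $e \mapsto e^g$ induced by conjugation with elements $g \in G$ satisfying $E^g \leq F$. *)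

(* Defs.v *)
From HB Require Import structures.
From mathcomp Require Import all_boot all_order all_fingroup all_solvable all_algebra.
Set Implicit Arguments. Unset Strict Implicit. Unset Printing Implicit Defensive.
Import GRing.Theory.

(* 1. p-adic lattices.  An element of T = Z_p^d is represented by its *)
(* coordinates, each a compatible system of truncations a n in       *)
(* [0, p^n) with a (n+1) = a n mod p^n (canonical representation).     *)
(* Raw type V; the genuine elements of T are those satisfying inT.     *)
Section Padic.
Variables (p d : nat).

Definition V := 'I_d -> nat -> nat.
Definition inT (t : V) : Prop :=
  forall i n, t i n < p ^ n /\ t i n.+1 %% p ^ n = t i n.
Definition v0 : V := fun _ _ => 0.
Definition vadd (t u : V) : V := fun i n => (t i n + u i n) %% p ^ n.
Definition vopp (t : V) : V := fun i n => (p ^ n - t i n) %% p ^ n.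
Definition vscale (c : nat) (t : V) : V := fun i n => (c * t i n) %% p ^ n.
(* p^n T = elements of T whose truncation at level n vanishes *)
Definition pT (n : nat) (t : V) : Prop := inT t /\ forall i, t i n = 0.

(* M k = T / p^k T = (Z/p^k)^d ; note (p^k).-1.+1 = p^k as p > 0 *)
Definition M (k : nat) := {ffun 'I_d -> 'I_((p ^ k).-1.+1)}.
Definition projM k (t : V) : M k := [ffun i => inord (t i k)].
Definition liftM k (m : M k) : V := fun i n => (nat_of_ord (m i)) %% p ^ n.
Definition mulM k (m : M k) : M k.+1 := [ffun i => inord (p * m i)].
End Padic.
Arguments inT p {d}.
Arguments v0 {d}.
Arguments vadd p {d}.
Arguments vopp p {d}.
Arguments vscale p {d}.
Arguments pT p {d}.
Arguments projM p d k t : clear implicits.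
Arguments liftM {p d k} m.
Arguments mulM {p d k} m.

Section Cohom.
Variables (P : finGroupType) (A : Type) (add : A -> A -> A) (opp : A -> A)
  (zero : A) (act : A -> P -> A).

Definition normalized2 (c : P -> P -> A) :=
  forall g, c 1%g g = zero /\ c g 1%g = zero.
(* tau in Z^2(P,A): exactly the condition making Ext(tau) associative *)
Definition cocycle2 (c : P -> P -> A) :=
  normalized2 c /\
  forall g h k, add (act (c g h) k) (c (g * h)%g k) = add (c h k) (c g (h * k)%g).
Definition delta2 (c : P -> P -> A) : P -> P -> P -> A :=
  fun g h k => add (add (add (c h k) (opp (c (g * h)%g k))) (c g (h * k)%g))
                   (opp (act (c g h) k)).
Definition normalized3 (z : P -> P -> P -> A) :=
  forall g h, z 1%g g h = zero /\ z g 1%g h = zero /\ z g h 1%g = zero.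
Definition delta3 (z : P -> P -> P -> A) : P -> P -> P -> P -> A :=
  fun g h k l =>
    add (add (add (add (z h k l) (opp (z (g * h)%g k l))) (z g (h * k)%g l))
             (opp (z g h (k * l)%g)))
        (act (z g h k) l).
Definition cocycle3 (z : P -> P -> P -> A) :=
  normalized3 z /\ forall g h k l, delta3 z g h k l = zero.
End Cohom.

Inductive gen (X : Type) (mul : X -> X -> X) (inv : X -> X) (one : X)
    (S : X -> Prop) : X -> Prop :=
  | gen_one : gen mul inv one S one
  | gen_in x : S x -> gen mul inv one S x
  | gen_mul x y : gen mul inv one S x -> gen mul inv one S y ->
                  gen mul inv one S (mul x y)
  | gen_inv x : gen mul inv one S x -> gen mul inv one S (inv x).

Section ProP.
Variables (p d : nat) (P : finGroupType) (act : V d -> P -> V d)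
  (rho : P -> P -> V d).

Definition SElt := (P * V d)%type.
Definition mulS (a b : SElt) : SElt :=
  ((a.1 * b.1)%g, vadd p (vadd p (act a.2 b.1) b.2) (rho a.1 b.1)).
Definition invS (a : SElt) : SElt :=
  ((a.1)^-1%g, vadd p (vopp p (act a.2 (a.1)^-1%g)) (vopp p (rho a.1 (a.1)^-1%g))).
Definition oneS : SElt := (1%g, @v0 d).
Definition commS (a b : SElt) : SElt := mulS (mulS (mulS (invS a) (invS b)) a) b.
Definition inS (s : SElt) : Prop := inT p s.2.
Definition inTT (s : SElt) : Prop := s.1 = 1%g /\ inT p s.2.
(* topological closure in S: the p^n T, n >= 0, form a base of open
   neighbourhoods of 1 in S *)
Definition closureS (B : SElt -> Prop) (s : SElt) : Prop :=
  forall n, exists a t, B a /\ pT p n t /\ s = mulS a (1%g, t).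
Definition commsub (B C : SElt -> Prop) : SElt -> Prop :=
  closureS (gen mulS invS oneS (fun s => exists a b, B a /\ C b /\ s = commS a b)).
(* lcs n = gamma_(n+1)(S) *)
Fixpoint lcs (n : nat) : SElt -> Prop :=
  if n is n'.+1 then commsub (lcs n') inS else inS.
Fixpoint Tser (i : nat) : SElt -> Prop :=
  if i is i'.+1 then commsub (Tser i') inS else inTT.
Definition has_index (B C : SElt -> Prop) (n : nat) : Prop :=
  exists r : 'I_n -> SElt, (forall j, B (r j)) /\
    forall a, B a -> exists! j, C (mulS (invS (r j)) a).

Definition setting : Prop :=
  [/\ (forall t g, inT p t -> inT p (act t g)),
      (forall t, inT p t -> act t 1%g = t),
      (forall t g h, inT p t -> act t (g * h)%g = act (act t g) h) &
      (forall t u g, inT p t -> inT p u ->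
          act (vadd p t u) g = vadd p (act t g) (act u g))] /\
  ((forall g h, inT p (rho g h)) /\ cocycle2 (vadd p) (@v0 d) act rho) /\
  (exists l, forall s, lcs l s <-> inTT s) /\
  (forall i, has_index (Tser i) (Tser i.+1) p).
End ProP.

Section Family.
Variables (p d : nat) (P : finGroupType) (act : V d -> P -> V d)
  (rho : P -> P -> V d).

Definition mP := logn p #|[set: P]|.
Definition ee := 3 * mP.

Definition actM k (m : M p d k) (g : P) : M p d k :=
  projM p d k (act (liftM m) g).

Definition Z2M k (c : P -> P -> M p d k) : Prop :=
  cocycle2 (@GRing.add (M p d k)) 0%R (@actM k) c.
Definition I2M k (c : P -> P -> M p d k) : Prop :=
  exists s : P -> P -> V d, (forall g h, inT p (s g h)) /\
    cocycle2 (vadd p) (@v0 d) act s /\ c = (fun g h => projM p d k (s g h)).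
(* image of Z^2(P, p^(k-m)T/p^k T) in Z^2(P, M k) *)
Definition J2M k (c : P -> P -> M p d k) : Prop :=
  exists s : P -> P -> M p d k,
    cocycle2 (@GRing.add (M p d k)) 0%R (@actM k) s /\
    (forall g h, exists u : M p d k, s g h = (u *+ (p ^ (k - mP)))%R) /\ c = s.

Definition admissible_K (K : forall x, (P -> P -> M p d (x + ee)) -> Prop) :=
  forall x,
  [/\ (forall c, K x c -> Z2M c),
      K x (fun _ _ => 0%R) &
      (forall a b, K x a -> K x b -> K x (fun g h => a g h - b g h)%R)] /\
  (forall c, K x c -> I2M c -> c = (fun _ _ => 0%R)) /\
  (forall c, Z2M c -> exists a b, I2M a /\ K x b /\ c = (fun g h => a g h + b g h)%R) /\
  (forall c, K x c -> J2M c) /\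
  (forall c, K x.+1 c <-> exists b, K x b /\ c = (fun g h => mulM (b g h))).

(* c in Z^2(P,M_x) is mapped to the class of the 3-cocycle z in H^3(P,T)
   by: connecting homomorphism of 0 -> p^(x+e)T -> T -> M_x -> 0 followed
   by division by p^(x+e) *)
Definition maps_to_class x (c : P -> P -> M p d (x + ee))
    (z : P -> P -> P -> V d) : Prop :=
  exists chat : P -> P -> V d,
    [/\ (forall g h, inT p (chat g h)), normalized2 (@v0 d) chat,
        (forall g h, projM p d (x + ee) (chat g h) = c g h) &
        exists w : P -> P -> V d,
          [/\ (forall g h, inT p (w g h)), normalized2 (@v0 d) w &
              forall g h k,
                delta2 (vadd p) (vopp p) act chat g h k =
                vscale p (p ^ (x + ee))
                  (vadd p (z g h k) (delta2 (vadd p) (vopp p) act w g h k))]].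

Definition tauX (eta : forall x, P -> P -> M p d (x + ee)) x :
    P -> P -> M p d (x + ee) :=
  fun g h => (projM p d (x + ee) (rho g h) + eta x g h)%R.
End Family.

Record pcat := PCat {
  ob : Type; mor : Type;
  isob : ob -> Prop;
  ishom : ob -> ob -> mor -> Prop;
  idm : ob -> mor;
  cmp : ob -> mor -> mor -> mor  (* cmp A g f = g o f, f with source A *)
}.

Definition is_functor (C D : pcat) (FO : ob C -> ob D)
    (FM : ob C -> ob C -> mor C -> mor D) : Prop :=
  [/\ (forall A, isob A -> isob (FO A)),
      (forall A B f, isob A -> isob B -> ishom A B f ->
         ishom (FO A) (FO B) (FM A B f)),
      (forall A, isob A -> FM A A (idm A) = idm (FO A)) &
      (forall A B E f g, isob A -> isob B -> isob E -> ishom A B f -> ishom B E g ->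
         FM A E (cmp A g f) = cmp (FO A) (FM B E g) (FM A B f))].

Definition natiso (C D : pcat) (FO : ob C -> ob D)
    (FM : ob C -> ob C -> mor C -> mor D) (GO : ob C -> ob D)
    (GM : ob C -> ob C -> mor C -> mor D) : Prop :=
  exists eta eps : ob C -> mor D,
    forall A, isob A ->
      [/\ ishom (FO A) (GO A) (eta A), ishom (GO A) (FO A) (eps A),
          cmp (FO A) (eps A) (eta A) = idm (FO A),
          cmp (GO A) (eta A) (eps A) = idm (GO A) &
          forall B f, isob B -> ishom A B f ->
            cmp (FO A) (GM A B f) (eta A) = cmp (FO A) (eta B) (FM A B f)].

Definition cat_equiv (C D : pcat) : Prop :=
  exists (FO : ob C -> ob D) (FM : ob C -> ob C -> mor C -> mor D)
         (GO : ob D -> ob C) (GM : ob D -> ob D -> mor D -> mor C),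
  [/\ is_functor FO FM, is_functor GO GM,
      natiso (fun A => GO (FO A)) (fun A B f => GM (FO A) (FO B) (FM A B f))
             (fun A => A) (fun _ _ f => f) &
      natiso (fun A => FO (GO A)) (fun A B f => FM (GO A) (GO B) (GM A B f))
             (fun A => A) (fun _ _ f => f)].

Section Quillen.
Variables (X : finType) (mul : X -> X -> X) (inv : X -> X) (one : X) (p : nat).

Definition conjX (x y : X) : X := mul (mul (inv y) x) y.
Definition elemab (E : {set X}) : Prop :=
  [/\ one \in E,
      (forall a b, a \in E -> b \in E -> mul a b \in E),
      (forall a, a \in E -> inv a \in E),
      (forall a b, a \in E -> b \in E -> mul a b = mul b a) &
      (forall a, a \in E -> iter p (mul a) one = one)].
Definition qhom (E F : {set X}) (phi : X -> X) : Prop :=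
  exists y, (forall a, a \in E -> conjX a y \in F) /\
            phi = (fun a => if a \in E then conjX a y else a).
Definition Quillen : pcat :=
  @PCat {set X} (X -> X) elemab qhom (fun _ a => a)
        (fun E g f a => if a \in E then g (f a) else a).
End Quillen.

Section ExtGroup.
Variables (p d : nat) (P : finGroupType) (act : V d -> P -> V d) (k : nat)
  (tau : P -> P -> M p d k).
Definition XE := (P * M p d k)%type.
Definition mulE (a b : XE) : XE :=
  ((a.1 * b.1)%g, (actM act a.2 b.1 + b.2 + tau a.1 b.1)%R).
Definition invE (a : XE) : XE :=
  ((a.1)^-1%g, (- actM act a.2 (a.1)^-1%g - tau a.1 (a.1)^-1%g)%R).
Definition oneE : XE := (1%g, 0%R).
Definition QuillenExt : pcat := Quillen mulE invE oneE p.
End ExtGroup.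

(* Main.v *)
Require Import Defs.
From HB Require Import structures.
From mathcomp Require Import all_boot all_order all_fingroup all_solvable all_algebra.
From mathcomp Require Import boolp ring.
Set Implicit Arguments. Unset Strict Implicit. Unset Printing Implicit Defensive.
Import GRing.Theory Defs.

(* Multiplication by p carries eta_x to eta_(x+1), since both have the same
   image in H^3(P,T) and K^2 -> H^3 is injective; as eta_0 lies in J^2, there is
   one c : P x P -> T with eta_(x+1) = p^(x+2m) c mod p^(x+1+3m).  Hence
   (g,t,w) |-> (g, t + p^x w) maps the fibre product over P of S = Ext(rho) and
   the finite group Ext(p^(2m) c mod p^(3m+1)), which does not depend on x, onto
   G_(x+1).
   Over the image Q <= P of an elementary abelian E <= G_(x+1), averaging a
   2-cocycle over Q shows that rho splits exactly on Q, and E lifts to the fibre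
   product with all w-coordinates in p^m T.  If an element of G_(x+1) conjugates
   E into F, averaging a 1-cocycle shows that it has a preimage which
   conjugates the lift of E into the lift of F.  So objects and morphisms of the
   Quillen category are described by data independent of x, and x_0 = 1 works. *)

(** * Arithmetic of T = Z_p^d and of its quotients T / p^k T *)

Section Lattice.
Local Open Scope ring_scope.
Variables (p d : nat).

Lemma inT_modn (t : V d) (tT : inT p t) i n k : (t i (n + k) %% p ^ n)%N = t i n.
Proof.
elim: k => [|k IH]; first by rewrite addn0 modn_small //; case: (tT i n).
rewrite addnS -{}IH -(proj2 (tT i (n + k)%N)).
by rewrite modn_dvdm // dvdn_exp2l // leq_addr.
Qed.

Hypothesis p_pr : prime p.
Let pX_gt0 n : (0 < p ^ n)%N. Proof. by rewrite expn_gt0 prime_gt0. Qed.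

(** Each operation reduces an integer formula mod p^n at level n, so closure of T comes down to one
    congruence between consecutive levels. *)
Lemma inT_compat (f : 'I_d -> nat -> nat) :
    (forall i n, f i n.+1 = f i n %[mod p ^ n])%N ->
  inT p (fun i n => f i n %% p ^ n)%N.
Proof.
by move=> fS i n; split; rewrite ?ltn_mod // modn_dvdm ?fS // dvdn_exp2l.
Qed.

Lemma inT_eqmod (t : V d) (tT : inT p t) i n : (t i n.+1 = t i n %[mod p ^ n])%N.
Proof. by case: (tT i n) => lt_n ->; rewrite modn_small. Qed.

Lemma inT0 : inT p (@v0 d).
Proof. by move=> i n; rewrite /v0 mod0n. Qed.

Lemma inT_vadd (t u : V d) : inT p t -> inT p u -> inT p (vadd p t u).
Proof.
move=> tT uT; apply: inT_compat => i n.
by rewrite -modnDm !inT_eqmod // modnDm.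
Qed.

Lemma inT_vopp (t : V d) : inT p t -> inT p (vopp p t).
Proof.
move=> tT; apply: inT_compat => i n.
have leX m : (t i m <= p ^ m)%N by rewrite ltnW //; case: (tT i m).
apply/eqP; rewrite -(eqn_modDr (t i n.+1)) subnK // -[in eqbRHS]modnDmr inT_eqmod //.
by rewrite modnDmr subnK // modnn -(modnn (p ^ n)) expnS modnMl modnn.
Qed.

(** The product of Z_p^d turns T into a commutative ring, so that [ring] can decide additive
    identities in T. *)
Definition vone : V d := fun _ n => (1 %% p ^ n)%N.
Definition vmul (t u : V d) : V d := fun i n => (t i n * u i n %% p ^ n)%N.

Lemma inT_vone : inT p vone.
Proof. exact: inT_compat. Qed.

Lemma inT_vmul (t u : V d) : inT p t -> inT p u -> inT p (vmul t u).
Proof.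
move=> tT uT; apply: inT_compat => i n.
by rewrite -modnMm !inT_eqmod // modnMm.
Qed.

Lemma inT_liftM k (m : M p d k) : inT p (liftM m).
Proof. exact: inT_compat. Qed.

End Lattice.

(* The primality proof is a parameter of the type so that the ring
   structure below needs no side condition. *)
Definition padic p d (_ : prime p) := {t : V d | inT p t}.
Definition pv p d (pp : prime p) (t : padic d pp) : V d := proj1_sig t.
Definition mkp p d (pp : prime p) (t : V d) (tT : inT p t) : padic d pp := exist _ t tT.

Section PadicRing.
Local Open Scope ring_scope.
Variables (p d : nat) (pp : prime p).
Local Notation T := (padic d pp).
Let pX_gt0 n : (0 < p ^ n)%N. Proof. by rewrite expn_gt0 prime_gt0. Qed.

Lemma pvP (t : T) : inT p (pv t). Proof. exact: proj2_sig. Qed.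

Lemma pv_inj : injective (@pv p d pp).
Proof.
by case=> [t tT] [u uT]; rewrite /pv /= => e; subst u; rewrite (Prop_irrelevance tT uT).
Qed.

Lemma pv_eq (t u : T) : (forall i n, pv t i n = pv u i n) -> t = u.
Proof. by move=> e; apply: pv_inj; apply: funext => i; apply: funext => n. Qed.

Lemma pv_mod (t : T) i n : (pv t i n %% p ^ n)%N = pv t i n.
Proof. by rewrite modn_small //; case: (pvP t i n). Qed.

HB.instance Definition _ := gen_eqMixin T.
HB.instance Definition _ := gen_choiceMixin T.

Definition padd (t u : T) : T := mkp pp (inT_vadd pp (pvP t) (pvP u)).
Definition popp (t : T) : T := mkp pp (inT_vopp pp (pvP t)).
Definition pzero : T := mkp pp (@inT0 p d pp).
Definition pmul (t u : T) : T := mkp pp (inT_vmul pp (pvP t) (pvP u)).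
Definition pone : T := mkp pp (@inT_vone p d pp).

Let paddA : associative padd.
Proof. by move=> a b c; apply: pv_eq => i n /=; rewrite /vadd modnDml modnDmr addnA. Qed.
Let paddC : commutative padd.
Proof. by move=> a b; apply: pv_eq => i n /=; rewrite /vadd addnC. Qed.
Let padd0 : left_id pzero padd.
Proof. by move=> a; apply: pv_eq => i n /=; rewrite /vadd add0n pv_mod. Qed.
Let paddN : left_inverse pzero popp padd.
Proof.
move=> a; apply: pv_eq => i n /=; rewrite /vadd /vopp /= modnDml subnK ?modnn //.
by rewrite ltnW //; case: (pvP a i n).
Qed.
Let pmulA : associative pmul.
Proof. by move=> a b c; apply: pv_eq => i n /=; rewrite /vmul modnMml modnMmr mulnA. Qed.
Let pmulC : commutative pmul.
Proof. by move=> a b; apply: pv_eq => i n /=; rewrite /vmul mulnC. Qed.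
Let pmul1 : left_id pone pmul.
Proof. by move=> a; apply: pv_eq => i n /=; rewrite /vmul modnMml mul1n pv_mod. Qed.
Let pmulD : left_distributive pmul padd.
Proof.
move=> a b c; apply: pv_eq => i n /=; rewrite /vmul /vadd /=.
by rewrite modnMml modnDm mulnDl.
Qed.

HB.instance Definition _ := GRing.isZmodule.Build T paddA paddC padd0 paddN.
HB.instance Definition _ := GRing.Zmodule_isComPzRing.Build T pmulA pmulC pmul1 pmulD.

Lemma pvD (t u : T) : pv (t + u) = vadd p (pv t) (pv u). Proof. by []. Qed.

Lemma pvMn (t : T) c : pv (t *+ c) = vscale p c (pv t).
Proof.
apply: funext => i; apply: funext => n; rewrite /vscale.
elim: c => [|c IH]; first by rewrite mul0n mod0n.
by rewrite mulrS pvD /vadd IH modnDmr mulSn.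
Qed.

(** If p^n t = 0, then p^k divides level k + n of t, whose residue mod p^k is level k of t. *)
Lemma pMn_inj n : injective (fun t : T => t *+ p ^ n).
Proof.
move=> t u /= e; apply/eqP; rewrite -subr_eq0; apply/eqP; move/eqP: e.
rewrite -subr_eq0 -mulrnBl => /eqP; move: (t - u) => {t u} t e.
apply: pv_eq => i k; have := congr1 (fun t => pv t i (k + n)%N) e.
rewrite pvMn /vscale /= => /eqP; rewrite -/(dvdn _ _) (addnC k) expnD dvdn_pmul2l //.
by rewrite addnC => /eqP; rewrite (inT_modn (pvP t)).
Qed.

Definition pr k (t : T) : M p d k := projM p d k (pv t).

Let pXE k : (p ^ k).-1.+1 = (p ^ k)%N. Proof. by rewrite prednK. Qed.

Lemma prE k (t : T) i : pr k t i = pv t i k :> nat.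
Proof. by rewrite ffunE inordK // pXE; case: (pvP t i k). Qed.

Lemma prD k : {morph pr k : t u / t + u}.
Proof.
move=> t u; apply/ffunP => i; apply: val_inj; rewrite [RHS]/= !ffunE /=.
by rewrite !inordK pXE //; [case: (pvP u i k) | case: (pvP t i k) | case: (pvP (t + u) i k)].
Qed.

Lemma pr0 k : pr k 0 = 0.
Proof. by apply: (addIr (pr k 0)); rewrite -prD !add0r. Qed.

HB.instance Definition _ k := GRing.isNmodMorphism.Build T (M p d k) (pr k) (conj (pr0 k) (prD k)).

Definition prlift k (m : M p d k) : T := mkp pp (inT_liftM pp m).

Lemma prliftK k : cancel (@prlift k) (pr k).
Proof.
move=> m; apply/ffunP => i; apply: val_inj; rewrite [LHS]prE.
by rewrite /= /liftM modn_small // -[X in (_ < X)%N]pXE.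
Qed.

Lemma pr_eq0 k (t : T) : pr k t = 0 <-> exists u, t = u *+ p ^ k.
Proof.
split=> [e|[u ->]]; last first.
  apply/ffunP => i; apply: val_inj; rewrite [LHS]prE ffunE /=.
  by rewrite pvMn /vscale modnMr.
have e0 i : pv t i k = 0%N by rewrite -prE e ffunE.
have dv i n : (p ^ k %| pv t i (k + n))%N by rewrite /dvdn (inT_modn (pvP t)) e0.
(* Division by p^k shifts levels: level n of the quotient is level k + n of t, divided by p^k. *)
have uT : inT p (fun i n => pv t i (k + n) %/ p ^ k)%N.
  move=> i n; split.
    by rewrite ltn_divLR // -expnD addnC; case: (pvP t i (n + k)%N).
  apply/eqP; rewrite -(eqn_pmul2r (pX_gt0 k)) muln_modl -expnD.
  by rewrite !divnK // addnS addnC (proj2 (pvP t i (n + k)%N)).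
exists (mkp pp uT); apply: pv_eq => i n; rewrite pvMn /vscale /= mulnC divnK //.
by rewrite addnC (inT_modn (pvP t)).
Qed.

Lemma mulM_pr k (t : T) : mulM (pr k t) = pr k.+1 (t *+ p).
Proof.
apply/ffunP => i; apply: val_inj; rewrite [RHS]prE.
rewrite ffunE [LHS]/= -/(nat_of_ord _) inordK prE ?pXE; last first.
  by rewrite expnS ltn_pmul2l ?prime_gt0 //; case: (pvP t i k).
by rewrite pvMn /vscale expnS -muln_modr (proj2 (pvP t i k)).
Qed.

End PadicRing.

(** * Groups given by bare operations, and the morphisms of their Quillen categories *)

Definition group_law (X : Type) (mul : X -> X -> X) (inv : X -> X) (one : X) :=
  [/\ associative mul, left_id one mul, right_id one mul & right_inverse one inv mul].

Section GroupLaw.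
Variables (X : Type) (mul : X -> X -> X) (inv : X -> X) (one : X).
Hypothesis G : group_law mul inv one.

Lemma group_lawV : left_inverse one inv mul.
Proof.
case: G => mA m1 m1r mV x.
have: mul (mul (inv x) x) (mul (inv x) (inv (inv x))) = one.
  by rewrite mA -(mA (inv x) x) mV m1r mV.
by rewrite mV m1r.
Qed.

Lemma group_law_mulI x : injective (mul x).
Proof.
case: G => mA m1 _ _ y z /(congr1 (mul (inv x))).
by rewrite !mA group_lawV !m1.
Qed.

Lemma group_law_idem x : mul x x = x -> x = one.
Proof. by case: G => _ _ m1 _ e; apply: (@group_law_mulI x); rewrite e m1. Qed.

Lemma group_law_inv x y : mul x y = one -> y = inv x.
Proof. by case: G => _ _ _ mV e; apply: (@group_law_mulI x); rewrite e mV. Qed.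

End GroupLaw.

(** The right-hand side is free of inverses, so that [glueM] can compute it in coordinates. *)
Lemma conjX_eq (X : finType) mul inv (one x y z : X) :
  group_law mul inv one -> conjX mul inv x y = z <-> mul x y = mul y z.
Proof.
move=> G; case: (G) => mA m1 _ mV; rewrite /conjX -mA; split=> [<-|->].
  by rewrite mA mV m1.
by rewrite mA (group_lawV G) m1.
Qed.

Lemma elemab_imset (X Y : finType) (mulX : X -> X -> X) invX oneX
    (mulY : Y -> Y -> Y) invY oneY p (f : X -> Y) (E : {set X}) :
    group_law mulX invX oneX -> group_law mulY invY oneY ->
    elemab mulX invX oneX p E ->
    {in E &, forall a b, f (mulX a b) = mulY (f a) (f b)} ->
  elemab mulY invY oneY p (f @: E).
Proof.
move=> GX GY [E1 EM EV EC Ep] fM.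
have f1 : f oneX = oneY.
  by apply: (group_law_idem GY); rewrite -fM //; case: GX => _ -> _ _.
split.
- by rewrite -f1 imset_f.
- by move=> _ _ /imsetP[a Ea ->] /imsetP[b Eb ->]; rewrite -fM // imset_f // EM.
- move=> _ /imsetP[a Ea ->]; rewrite -(@group_law_inv _ _ _ _ GY (f a) (f (invX a))).
    by rewrite imset_f // EV.
  by rewrite -fM ?EV //; case: GX => _ _ _ ->.
- by move=> _ _ /imsetP[a Ea ->] /imsetP[b Eb ->]; rewrite -!fM // EC.
- move=> _ /imsetP[a Ea ->]; rewrite -f1 -[in RHS](Ep a Ea).
  elim: p {Ep} => //= n IH; rewrite IH fM //.
  by elim: n {IH} => //= n IH; rewrite EM.
Qed.

(** Morphisms of [Quillen] are functions on the whole type that fix everything outside their source.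
    In this normal form, agreement on E yields equality of morphisms. *)
Definition extend_id (Z : finType) (E : {set Z}) (f : Z -> Z) : Z -> Z :=
  fun a => if a \in E then f a else a.

Lemma extend_idE (Z : finType) (E : {set Z}) (f : Z -> Z) a :
  a \in E -> extend_id E f a = f a.
Proof. by rewrite /extend_id => ->. Qed.

Lemma eq_extend_id (Z : finType) (E : {set Z}) (f g : Z -> Z) :
  {in E, f =1 g} -> extend_id E f = extend_id E g.
Proof. by move=> fg; apply: funext => a; rewrite /extend_id; case: ifP => // /fg. Qed.

Lemma extend_id_id (Z : finType) (E : {set Z}) (f : Z -> Z) :
  {in E, forall a, f a = a} -> extend_id E f = id.
Proof. by move=> fK; apply: funext => a; rewrite /extend_id; case: ifP => // /fK. Qed.

Lemma qhom_id (Z : finType) mul inv one (E : {set Z}) :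
  group_law mul inv one -> qhom mul inv E E id.
Proof.
move=> G; have cj a : conjX mul inv a one = a.
  by apply/(conjX_eq _ _ _ G); case: G => _ m1 m1r _; rewrite m1 m1r.
exists one; split=> [a|]; first by rewrite cj.
by apply: funext => a; rewrite cj if_same.
Qed.

Lemma qhom_in (Z : finType) mul inv (E F : {set Z}) (f : Z -> Z) a :
  qhom mul inv E F f -> a \in E -> f a \in F.
Proof. by case=> y [yEF ->] aE; rewrite aE yEF. Qed.

(** * Equivalence of Quillen categories from a system of links *)

Section QuillenEquiv.
Variables (X Y : finType) (mulX : X -> X -> X) (invX : X -> X) (oneX : X)
  (mulY : Y -> Y -> Y) (invY : Y -> Y) (oneY : Y) (p : nat).
Hypotheses (GX : group_law mulX invX oneX) (GY : group_law mulY invY oneY).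
Local Notation obX := (elemab mulX invX oneX p).
Local Notation obY := (elemab mulY invY oneY p).
Local Notation homX := (qhom mulX invX).
Local Notation homY := (qhom mulY invY).

(* [link E F u v] says that [u] and [v] are the two halves of one fixed way of
   identifying [E] with [F]; transport along links preserves morphisms. *)
Variable link : {set X} -> {set Y} -> (X -> Y) -> (Y -> X) -> Prop.
Hypothesis link_bij : forall E F u v, link E F u v ->
  [/\ obX E, obY F, forall a, a \in E -> u a \in F /\ v (u a) = a &
      forall b, b \in F -> v b \in E /\ u (v b) = b].
Hypothesis link_exX : forall E, obX E -> exists F u v, link E F u v.
Hypothesis link_exY : forall F, obY F -> exists E u v, link E F u v.
Hypothesis link_homY : forall E1 F1 u1 v1 E2 F2 u2 v2 f,
  link E1 F1 u1 v1 -> link E2 F2 u2 v2 -> homX E1 E2 f ->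
  homY F1 F2 (extend_id F1 (fun b => u2 (f (v1 b)))).
Hypothesis link_homX : forall E1 F1 u1 v1 E2 F2 u2 v2 g,
  link E1 F1 u1 v1 -> link E2 F2 u2 v2 -> homY F1 F2 g ->
  homX E1 E2 (extend_id E1 (fun a => v2 (g (u1 a)))).

Lemma link_cat_equiv :
  cat_equiv (Quillen mulX invX oneX p) (Quillen mulY invY oneY p).
Proof.
have exF E : exists t : {set Y} * (X -> Y) * (Y -> X),
    obX E -> link E t.1.1 t.1.2 t.2.
  have [/link_exX [F [u [v L]]]|nE] := pselect (obX E); first by exists (F, u, v).
  (* A placeholder: [choice] needs a value also where E is not an object. *)
  by exists (set0, fun=> oneY, fun=> oneX).
have exG F : exists t : {set X} * (X -> Y) * (Y -> X),
    obY F -> link t.1.1 F t.1.2 t.2.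
  have [/link_exY [E [u [v L]]]|nE] := pselect (obY F); first by exists (E, u, v).
  by exists (set0, fun=> oneY, fun=> oneX).
have [FO FOP] := choice exF; have [GO GOP] := choice exG.
pose FM (A B : {set X}) f := extend_id (FO A).1.1 (fun b => (FO B).1.2 (f ((FO A).2 b))).
pose GM (A B : {set Y}) g := extend_id (GO A).1.1 (fun a => (GO B).2 (g ((GO A).1.2 a))).
have FOob A : obX A -> obY (FO A).1.1 by move/FOP/link_bij => [].
have GOob A : obY A -> obX (GO A).1.1 by move/GOP/link_bij => [].
have FMhom A B f : obX A -> obX B -> homX A B f -> homY (FO A).1.1 (FO B).1.1 (FM A B f).
  by move=> /FOP LA /FOP LB; exact: (link_homY LA LB).
have GMhom A B g : obY A -> obY B -> homY A B g -> homX (GO A).1.1 (GO B).1.1 (GM A B g).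
  by move=> /GOP LA /GOP LB; exact: (link_homX LA LB).
exists (fun A => (FO A).1.1), FM, (fun A => (GO A).1.1), GM; split.
- split=> /=; [exact: FOob | exact: FMhom | move=> A Aob | ].
    by apply: extend_id_id => b; have [_ _ _ h] := link_bij (FOP _ Aob) => /h[].
  move=> A B E f g Aob Bob Eob fh gh.
  apply: eq_extend_id => b bF; have [_ _ _ /(_ b bF) [vA _]] := link_bij (FOP _ Aob).
  have [_ _ /(_ _ (qhom_in fh vA)) [uB vuB] _] := link_bij (FOP _ Bob).
  by rewrite vA /FM !extend_idE ?vuB.
- split=> /=; [exact: GOob | exact: GMhom | move=> A Aob | ].
    by apply: extend_id_id => b; have [_ _ h _] := link_bij (GOP _ Aob) => /h[].
  move=> A B E f g Aob Bob Eob fh gh.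
  apply: eq_extend_id => b bF; have [_ _ /(_ b bF) [vA _] _] := link_bij (GOP _ Aob).
  have [_ _ _ /(_ _ (qhom_in fh vA)) [uB vuB]] := link_bij (GOP _ Bob).
  by rewrite vA /GM !extend_idE ?vuB.
(* Each component is the identity of the image of A in the other category, transported back along
   the two links that end there; hence [link_homX] shows that it is a morphism. *)
- exists (fun A => let GF := GO (FO A).1.1 in
            extend_id GF.1.1 (fun a => (FO A).2 (GF.1.2 a))).
  exists (fun A => let GF := GO (FO A).1.1 in
            extend_id A (fun a => GF.2 ((FO A).1.2 a))).
  move=> A Aob /=; have LA := FOP _ Aob; have LG := GOP _ (FOob _ Aob).
  have [_ _ uA vA] := link_bij LA; have [_ _ uG vG] := link_bij LG.
  split.
  + exact: (link_homX LG LA (qhom_id _ GY)).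
  + exact: (link_homX LA LG (qhom_id _ GY)).
  + apply: extend_id_id => a aE; have [ua vua] := uG _ aE; have [va uva] := vA _ ua.
    by rewrite !extend_idE // uva vua.
  + apply: extend_id_id => a aE; have [ua vua] := uA _ aE; have [va uva] := vG _ ua.
    by rewrite !extend_idE // uva vua.
  + move=> B f Bob fh; apply: eq_extend_id => a aE.
    have LB := FOP _ Bob; have LH := GOP _ (FOob _ Bob).
    have [_ _ uB vB] := link_bij LB; have [_ _ uH vH] := link_bij LH.
    have [ua vua] := uG _ aE; have [va uva] := vA _ ua.
    have fB := qhom_in fh va; have [ub vub] := uB _ fB; have [vb uvb] := vH _ ub.
    by rewrite /GM /FM !extend_idE // ?uvb ?vub.
- exists (fun A => let FG := FO (GO A).1.1 in
            extend_id FG.1.1 (fun a => (GO A).1.2 (FG.2 a))).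
  exists (fun A => let FG := FO (GO A).1.1 in
            extend_id A (fun a => FG.1.2 ((GO A).2 a))).
  move=> A Aob /=; have LA := GOP _ Aob; have LG := FOP _ (GOob _ Aob).
  have [_ _ vA uA] := link_bij LA; have [_ _ vG uG] := link_bij LG.
  split.
  + exact: (link_homY LG LA (qhom_id _ GX)).
  + exact: (link_homY LA LG (qhom_id _ GX)).
  + apply: extend_id_id => a aE; have [ua vua] := uG _ aE; have [va uva] := vA _ ua.
    by rewrite !extend_idE // uva vua.
  + apply: extend_id_id => a aE; have [ua vua] := uA _ aE; have [va uva] := vG _ ua.
    by rewrite !extend_idE // uva vua.
  + move=> B f Bob fh; apply: eq_extend_id => a aE.
    have LB := GOP _ Bob; have LH := FOP _ (GOob _ Bob).
    have [_ _ vB uB] := link_bij LB; have [_ _ vH uH] := link_bij LH.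
    have [ua vua] := uG _ aE; have [va uva] := vA _ ua.
    have fB := qhom_in fh va; have [ub vub] := uB _ fB; have [vb uvb] := vH _ ub.
    by rewrite /GM /FM !extend_idE // ?uvb ?vub.
Qed.

End QuillenEquiv.

(** * The action of P on T, and averaging over subgroups of P *)

Definition lattice_action p d (P : finGroupType) (act : V d -> P -> V d) :=
  [/\ forall t g, inT p t -> inT p (act t g),
      forall t, inT p t -> act t 1%g = t,
      forall t g h, inT p t -> act t (g * h)%g = act (act t g) h &
      forall t u g, inT p t -> inT p u ->
        act (vadd p t u) g = vadd p (act t g) (act u g)].

Section Action.
Local Open Scope ring_scope.
Variables (p d : nat) (pp : prime p) (P : finGroupType) (act : V d -> P -> V d).
Hypothesis actP : lattice_action p act.
Local Notation T := (padic d pp).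

Definition actT (t : T) (g : P) : T :=
  mkp pp (let: And4 actT _ _ _ := actP in actT _ g (pvP t)).

Lemma actTD g : {morph actT^~ g : t u / t + u}.
Proof. by move=> t u; apply: pv_inj; case: actP => _ _ _; apply; apply: pvP. Qed.

Lemma actT1 t : actT t 1%g = t.
Proof. by apply: pv_inj; case: actP => _ e _ _; apply/e/pvP. Qed.

Lemma actTM t g h : actT t (g * h)%g = actT (actT t g) h.
Proof. by apply: pv_inj; case: actP => _ _ e _; apply/e/pvP. Qed.

Lemma actT0 g : actT 0 g = 0.
Proof. by apply: (addIr (actT 0 g)); rewrite -actTD !add0r. Qed.

Lemma actTN g : {morph actT^~ g : t / - t}.
Proof. by move=> t; apply: (addIr (actT t g)); rewrite -actTD !addNr actT0. Qed.

Lemma actTB g : {morph actT^~ g : t u / t - u}.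
Proof. by move=> t u; rewrite actTD actTN. Qed.

Lemma actTMn t n g : actT (t *+ n) g = actT t g *+ n.
Proof. by elim: n => [|n IH]; rewrite ?actT0 // !mulrS actTD IH. Qed.

Lemma actT_sum I (r : seq I) (Q : pred I) (F : I -> T) g :
  actT (\sum_(i <- r | Q i) F i) g = \sum_(i <- r | Q i) actT (F i) g.
Proof. exact: (big_morph (actT^~ g) (actTD g) (actT0 g)). Qed.

(** [actM] acts through one chosen lift. Any other lift differs from it by some p^k u, which the
    additive action sends to p^k times the image of u. *)
Lemma actM_pr k (t : T) g : actM act (pr k t) g = pr k (actT t g).
Proof.
have [u /eqP] : exists u : T, prlift pp (pr k t) - t = u *+ p ^ k.
  by apply/pr_eq0; rewrite raddfB /= prliftK subrr.
rewrite subr_eq => /eqP e.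
rewrite -[LHS]/(pr k (actT (prlift pp (pr k t)) g)) e actTD actTMn raddfD /=.
by rewrite (proj2 (pr_eq0 k _)) ?add0r //; exists (actT u g).
Qed.

Lemma prP k (m : M p d k) : exists t : T, m = pr k t.
Proof. by exists (prlift pp m); rewrite prliftK. Qed.

Lemma actMD k g : {morph (fun m : M p d k => actM act m g) : m n / m + n}.
Proof.
move=> m n; have [t ->] := prP m; have [u ->] := prP n.
by rewrite -raddfD !actM_pr -raddfD actTD.
Qed.

Lemma mulE_group k (tau : P -> P -> M p d k) :
    cocycle2 +%R 0 (@actM p d P act k) tau ->
  group_law (mulE act tau) (invE act tau) (@oneE p d P k).
Proof.
case=> tau1 tauA; split.
- case=> [g m] [h n] [l q]; congr (_, _); first by rewrite /= mulgA.
  have [t ->] := prP m; rewrite /= !actMD !actM_pr actTM -!addrA.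
  by do 2!congr (_ + _); rewrite [RHS]addrCA tauA.
- case=> g m; rewrite /mulE /= mul1g (proj1 (tau1 g)) addr0.
  by rewrite -(@pr0 p d pp k) actM_pr actT0 raddf0 add0r.
- case=> g m; rewrite /mulE /= mulg1 (proj2 (tau1 g)) !addr0.
  by have [t ->] := prP m; rewrite actM_pr actT1.
- by case=> g m; rewrite /mulE /= mulgV addrA subrr add0r addNr.
Qed.

Section Averaging.
Variable (m : nat).
Hypothesis cardP : #|[set: P]| = (p ^ m)%N.
Variable Q : {group P}.

Let cardQ : (p ^ m = #|Q| * #|[set: P] : Q|%g)%N.
Proof. by rewrite -cardP Lagrange // subsetT. Qed.

(** Let F be the sum of f over Q. Summing the identity over g in Q gives F = F^k + |Q| f(k). The
    further factor |P : Q| makes the multiplier p^m for every Q. *)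
Lemma cocycle1_split (f : P -> T) :
    {in Q &, forall g k, f (g * k)%g = actT (f g) k + f k} ->
  exists v, {in Q, forall k, f k *+ p ^ m = v - actT v k}.
Proof.
move=> fM; pose F := \sum_(g in Q) f g; exists (F *+ #|[set: P] : Q|%g) => k Qk.
rewrite actTMn -mulrnBl cardQ mulrnA; congr (_ *+ _).
have e : F = actT F k + f k *+ #|Q|.
  rewrite {1}/F (reindex_inj (mulIg k)) /= actT_sum -sumr_const -big_split /=.
  by apply: eq_big => [g|g]; rewrite groupMr // => Qg; apply: fM.
by rewrite {1}e addrC addKr.
Qed.

(** With F(h) the sum of c(g, h) over g in Q, summing the identity over its first argument gives
    F(h)^k + F(k) = |Q| c(h, k) + F(hk), because g -> gh permutes Q. *)
Lemma cocycle2_split (c : P -> P -> T) :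
    {in Q & &, forall g h k,
       actT (c g h) k + c (g * h)%g k = c h k + c g (h * k)%g} ->
  exists U : P -> T,
    {in Q &, forall g h, c g h *+ p ^ m = actT (U g) h + U h - U (g * h)%g}.
Proof.
move=> cA; pose F h := \sum_(g in Q) c g h.
exists (fun h => F h *+ #|[set: P] : Q|%g) => h k Qh Qk.
rewrite actTMn -mulrnDl -mulrnBl cardQ mulrnA; congr (_ *+ _).
have -> : F k = \sum_(g in Q) c (g * h)%g k.
  rewrite {1}/F (reindex_inj (mulIg h)) /=.
  by apply: eq_bigl => g; rewrite groupMr.
rewrite actT_sum -big_split -sumrB -sumr_const /=.
by apply: eq_bigr => g Qg; rewrite cA // addrK.
Qed.
End Averaging.
End Action.

(** * Coordinates on G_(x+1) whose multiplication does not depend on x *)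

Section Family.
Local Open Scope ring_scope.
Variables (p d : nat) (pp : prime p) (P : finGroupType) (act : V d -> P -> V d).
Hypothesis actP : lattice_action p act.
Variable m : nat.
Hypothesis cardP : #|[set: P]| = (p ^ m)%N.
Local Notation T := (padic d pp).
Local Notation "t ^^ g" := (actT actP t g) (at level 30).
Variables rho c : P -> P -> T.
Hypothesis rhoA : forall g h k,
  rho g h ^^ k + rho (g * h)%g k = rho h k + rho g (h * k)%g.

Local Notation lvl x := (x + 3 * m).+1.
(* Index shift: [tau x] is the cocycle of [G_(x+1)]. *)
Definition tau x g h : M p d (lvl x) :=
  pr (lvl x) (rho g h + c g h *+ p ^ (2 * m) *+ p ^ x).
Hypothesis tauZ : forall x, cocycle2 +%R 0 (@actM p d P act (lvl x)) (@tau x).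

Local Notation mul x := (mulE act (@tau x)).
Local Notation inv x := (invE act (@tau x)).
Local Notation one x := (@oneE p d P (lvl x)).
Local Notation Gr x := (XE p d P (lvl x)).

Let G x : group_law (mul x) (inv x) (one x) := mulE_group pp actP (tauZ x).

(* A homomorphism onto the extension by [tau x] from the fibre product over [P]
   of [Ext(rho)] and the finite group [Ext(p^(2m) c mod p^(3m+1))]; [t] and [w]
   are the coordinates in these two groups, [w] through a lift to [T]. *)
Definition glue x (g : P) (t w : T) : Gr x := (g, pr (lvl x) (t + w *+ p ^ x)).

(** Over fixed g and h, each coordinate of the product depends only on the same coordinate of the
    factors, and x enters neither formula. *)
Lemma glueM x g t w h u v :
  mul x (glue x g t w) (glue x h u v) =
  glue x (g * h)%g (t ^^ h + u + rho g h) (w ^^ h + v + c g h *+ p ^ (2 * m)).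
Proof.
congr (_, _); rewrite /= (actM_pr actP) actTD actTMn -!raddfD /=; congr (pr _ _).
by ring.
Qed.

Lemma glue_eqmod x g h t u w v : glue x g t w = glue x h u v ->
  exists z, t + w *+ p ^ x - (u + v *+ p ^ x) = z *+ p ^ lvl x.
Proof.
by case=> _ e; apply/pr_eq0; rewrite raddfB /= e subrr.
Qed.

(** Once the t-coordinates agree, the criterion no longer involves x. This is how equations pass
    from G_(x+1) to G_(y+1). *)
Lemma eq_glue x g t w v :
  glue x g t w = glue x g t v <-> exists z, w = v + z *+ p ^ (3 * m).+1.
Proof.
split=> [/glue_eqmod[z]|[z ->]].
  rewrite opprD addrACA subrr add0r -mulrnBl => /eqP.
  rewrite -addnS addnC expnD mulrnA => /eqP/pMn_inj/eqP.
  by rewrite subr_eq addrC => /eqP e'; exists z.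
congr (_, _); rewrite mulrnDl -mulrnA -expnD addSn addrA raddfD /=.
rewrite [X in _ + X](_ : _ = 0) ?addr0 //.
by apply/pr_eq0; exists z; rewrite addnC.
Qed.

(** The pairs (t, p^m w) lift E to the fibre product, with t a splitting of [rho] over the image of
    E in P. The factor p^m gives the 1-cocycle of [conj_transfer] the divisibility that averaging
    uses up. *)
Definition glued x (E : {set Gr x}) (t : P -> T) (w : Gr x -> T) :=
  {in E, forall a, a = glue x a.1 (t a.1) (w a *+ p ^ m)} /\
  {in E &, forall a b, t (a.1 * b.1)%g = t a.1 ^^ b.1 + t b.1 + rho a.1 b.1}.

(** Corresponding elements have the same coordinates, read once with p^x and once with p^y. *)
Definition link x y (E : {set Gr x}) (F : {set Gr y}) u v :=
  [/\ elemab (mul x) (inv x) (one x) p E, elemab (mul y) (inv y) (one y) p F,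
      forall a, a \in E -> u a \in F /\ v (u a) = a,
      forall b, b \in F -> v b \in E /\ u (v b) = b &
      exists t w, glued E t w /\ {in E, forall a, u a = glue y a.1 (t a.1) (w a *+ p ^ m)}].

Lemma link_sym x y (E : {set Gr x}) (F : {set Gr y}) u v : link E F u v -> link F E v u.
Proof.
case=> Eob Fob uE vF [t [w [[ew tM] uw]]]; split=> //.
have v1 b : b \in F -> (v b).1 = b.1.
  by move=> bF; have [vE uv] := vF _ bF; rewrite -[in RHS]uv uw.
exists t, (w \o v); split; [split|].
- by move=> b bF; have [vE uv] := vF _ bF; rewrite -[in LHS]uv uw //= v1.
- move=> a b aF bF; rewrite -!v1 //; apply: tM; [by case: (vF _ aF)|by case: (vF _ bF)].
- by move=> b bF; have [vE uv] := vF _ bF; rewrite [LHS]ew //= v1.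
Qed.

Lemma elemab_fst x (E : {set Gr x}) :
  elemab (mul x) (inv x) (one x) p E -> group_set [set a.1 | a in E].
Proof.
case=> E1 EM _ _ _; apply/group_setP; split; first by apply/imsetP; exists (one x).
move=> _ _ /imsetP[a Ea ->] /imsetP[b Eb ->].
by apply/imsetP; exists (mul x a b); rewrite ?EM.
Qed.

(** The quotient of two elements over the same g lies in M and is killed by p; as T is torsion-free,
    it comes from p^(x+3m) T. *)
Lemma elemab_fiber x (E : {set Gr x}) g (t u : T) :
    elemab (mul x) (inv x) (one x) p E ->
    (g, pr (lvl x) t) \in E -> (g, pr (lvl x) u) \in E ->
  exists z, u = t + z *+ p ^ (x + 3 * m).
Proof.
case=> E1 EM EV _ Ep tE uE; have [tau1 _] := tauZ x.
pose n := pr (lvl x) (u - t).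
have nE : (1%g, n) \in E.
  have : mul x (inv x (g, pr (lvl x) t)) (g, pr (lvl x) u) \in E by rewrite EM ?EV.
  congr (_ \in E); apply: (group_law_mulI (G x) (x := (g, pr (lvl x) t))).
  case: (G x) => mA m1 _ mV; rewrite mA mV m1 /mulE /= mulg1 (proj2 (tau1 g)) addr0.
  by rewrite (actM_pr actP) actT1 -raddfD /= addrC subrK.
have itn j : iter j (mul x (1%g, n)) (one x) = (1%g, n *+ j).
  elim: j => //= j ->; rewrite /mulE /= mulg1 (proj2 (tau1 _)) addr0 mulrS.
  by rewrite /n (actM_pr actP) actT1.
have [z e] : exists z, (u - t) *+ p = z *+ p ^ lvl x.
  apply/pr_eq0; rewrite raddfMn /=; have := Ep _ nE; rewrite itn.
  by case.
exists z; apply/eqP; rewrite addrC -subr_eq; apply/eqP/(@pMn_inj p d pp 1).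
by apply: etrans e _; rewrite expnSr mulrnA.
Qed.

(** Arbitrary lifts t0 miss being a splitting of [rho] by D = p^(x+2m) c', where c' is a 2-cocycle
    on Q. Averaging makes p^m c' the coboundary of some U, so t = t0 - p^(x+m) U is an exact
    splitting, and the correction moves into the w-coordinate. *)
Lemma glued_ex x (E : {set Gr x}) :
  elemab (mul x) (inv x) (one x) p E -> exists t w, glued E t w.
Proof.
move=> Eob; pose Q := group (elemab_fst Eob).
have memE a : a \in E -> exists t : T, a = (a.1, pr (lvl x) t).
  by case: a => g n _; have [t ->] := prP pp n; exists t.
have [t0 t0E] : {t0 : P -> T & forall g, g \in Q -> (g, pr (lvl x) (t0 g)) \in E}.
  apply: (choice (P := fun g t => g \in Q -> (g, pr (lvl x) t) \in E)) => g.
  have [|nQ] := boolP (g \in Q); last by exists 0.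
  by case/imsetP => a aE ->; have [t e] := memE a aE; exists t => _; rewrite -e.
pose D g h := t0 g ^^ h + t0 h + rho g h - t0 (g * h)%g.
have [c' Dc'] : {c' : P -> P -> T & forall g h, g \in Q -> h \in Q ->
    D g h = c' g h *+ p ^ (x + 2 * m)}.
  have ex gh : exists t, gh.1 \in Q -> gh.2 \in Q -> D gh.1 gh.2 = t *+ p ^ (x + 2 * m).
    case: gh => g h /=; have [gQ|] := boolP (g \in Q); last by exists 0.
    have [hQ|] := boolP (h \in Q); last by exists 0.
    have ghE : (g * h,
        pr (lvl x) (t0 g ^^ h + t0 h + (rho g h + c g h *+ p ^ (2 * m) *+ p ^ x)))%g \in E.
      case: (Eob) => _ EM _ _ _; have := EM _ _ (t0E _ gQ) (t0E _ hQ).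
      by rewrite /mulE /= (actM_pr actP) -!raddfD.
    have [z e] := elemab_fiber Eob (t0E _ (groupM gQ hQ)) ghE.
    (* D is the fibre term p^(x+3m) z minus the contribution p^(x+2m) c of the cocycle of
       G_(x+1). *)
    exists (z *+ p ^ m - c g h) => _ _; rewrite mulrnBl -mulrnA -expnD.
    rewrite (_ : m + (x + 2 * m) = x + 3 * m)%N; last by ring.
    rewrite -[z *+ _](addKr (t0 (g * h)%g)) -e /D expnD (mulnC (p ^ x)%N) mulrnA.
    by ring.
  by have [c' c'P] := choice ex; exists (fun g h => c' (g, h)) => g h; apply: (c'P (g, h)).
have c'A : {in Q & &, forall g h k,
    c' g h ^^ k + c' (g * h)%g k = c' h k + c' g (h * k)%g}.
  move=> g h k gQ hQ kQ; apply: (@pMn_inj p d pp (x + 2 * m)).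
  rewrite /= !mulrnDl -actTMn -!Dc' ?groupM // /D !actTD actTN -!actTM mulgA.
  apply/eqP; rewrite -subr_eq0; apply/eqP.
  have := rhoA g h k; move/eqP; rewrite -subr_eq0 => /eqP <-; ring.
have [U cU] := cocycle2_split cardP c'A.
pose t g := t0 g - U g *+ p ^ (x + m).
have [w wP] : {w : Gr x -> T & forall a, a \in E -> a = glue x a.1 (t a.1) (w a *+ p ^ m)}.
  apply: (choice (P := fun a w => a \in E -> a = glue x a.1 (t a.1) (w *+ p ^ m))) => a.
  have [aE|] := boolP (a \in E); last by exists 0.
  have [s sa] := memE a aE; have aQ : a.1 \in Q by apply: imset_f.
  have [z e] : exists z, s = t0 a.1 + z *+ p ^ (x + 3 * m).
    by apply: (elemab_fiber Eob (t0E _ aQ)); rewrite -sa.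
  (* This is t0 + p^(x+3m) z = t + p^x p^m (U + p^(2m) z). *)
  exists (U a.1 + z *+ p ^ (2 * m)) => _; rewrite [LHS]sa /glue e; congr (_, pr _ _).
  rewrite /t; move: (U a.1) (t0 a.1) => r s0.
  rewrite (_ : x + 3 * m = 2 * m + m + x)%N; last by ring.
  by rewrite (addnC x m) !expnD !mulrnA; ring.
exists t, w; split=> // a b aE bE.
have [aQ bQ] : a.1 \in Q /\ b.1 \in Q by split; apply: imset_f.
have := Dc' _ _ aQ bQ; rewrite (_ : x + 2 * m = m + (x + m))%N; last by ring.
rewrite expnD mulrnA cU // /D /t actTB actTMn => /eqP.
rewrite -subr_eq0 => /eqP e; apply/eqP; rewrite -subr_eq0 -[X in _ == X]oppr0 -e; apply/eqP; ring.
Qed.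

Lemma link_ex x y (E : {set Gr x}) :
  elemab (mul x) (inv x) (one x) p E -> exists (F : {set Gr y}) u v, link E F u v.
Proof.
move=> Eob; have [t [w [ew tM]]] := glued_ex Eob.
pose u a := glue y a.1 (t a.1) (w a *+ p ^ m).
have u_inj : {in E &, injective u}.
  move=> a b aE bE e; have e1 : a.1 = b.1 by case: e.
  move: e; rewrite /u e1 => /eq_glue e.
  by rewrite [LHS](ew a aE) [RHS](ew b bE) e1; apply/eq_glue.
pose v b := odflt (one x) [pick a in E | u a == b].
have uK a : a \in E -> v (u a) = a.
  rewrite /v; case: pickP => [b /andP[bE /eqP e]|/(_ a) na] aE; first exact: u_inj.
  by move: na; rewrite aE eqxx.
exists (u @: E), u, v; split=> //.
- apply: (elemab_imset (G x) (G y) Eob) => a b aE bE.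
  have abE : mul x a b \in E by case: (Eob) => _ -> .
  (* As t splits [rho], the element and the product have the same t-coordinate, so [eq_glue] carries
     the equation from x to y. *)
  have := ew _ abE; rewrite {1}(ew a aE) {1}(ew b bE) glueM -tM // => /esym/eq_glue e.
  by rewrite /u glueM -tM //; apply/eq_glue.
- by move=> a aE; rewrite imset_f ?uK.
- by move=> _ /imsetP[a aE ->]; rewrite uK.
- by exists t, w.
Qed.

(** For every v, the pair (s0 - p^x v, v) gives a preimage of s = (h, s0). A suitable v makes the
    conjugation equation exact in the t-coordinate; what remains is an equation of w-coordinates
    modulo p^(3m+1), valid for y as well. *)
Lemma conj_transfer x y (E1 E2 : {set Gr x}) t1 w1 t2 w2 s :
    elemab (mul x) (inv x) (one x) p E1 -> glued E1 t1 w1 -> glued E2 t2 w2 ->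
    {in E1, forall a, conjX (mul x) (inv x) a s \in E2} ->
  exists r : Gr y, {in E1, forall a, let b := conjX (mul x) (inv x) a s in
    conjX (mul y) (inv y) (glue y a.1 (t1 a.1) (w1 a *+ p ^ m)) r =
    glue y b.1 (t2 b.1) (w2 b *+ p ^ m)}.
Proof.
move=> E1ob [ew1 t1M] [ew2 t2M] sE; case: s sE => h sm; have [s0 ->] := prP pp sm => {sm}.
set s := (h, _) => sE.
have sglue v : s = glue x h (s0 - v *+ p ^ x) v by rewrite /glue subrK.
pose cj a := conjX (mul x) (inv x) a s.
have cjE a : mul x a s = mul x s (cj a) by apply/(conjX_eq _ _ _ (G x)).
(* [Q] is the image in P of the conjugate of E1, and [bwd] leads from it back to the image of E1. *)
pose Q := (group (elemab_fst E1ob) :^ h)%G.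
pose bwd g := (h * g * h^-1)%g.
have bwdM g k : bwd (g * k)%g = (bwd g * bwd k)%g by rewrite /bwd !mulgA mulgKV.
have bwdh g : (bwd g * h = h * g)%g by rewrite /bwd mulgKV.
have cj1 a : a.1 = bwd (cj a).1.
  by have [e _] := cjE a; rewrite /bwd -[(h * _)%g]e mulgK.
have QP g : g \in Q -> exists2 a, a \in E1 & a.1 = bwd g /\ (cj a).1 = g.
  rewrite mem_conjg conjgE invgK mulgA => /imsetP[a aE e]; exists a => //; split=> //.
  by move: e; rewrite (cj1 a) /bwd => /mulIg/mulgI.
(* In [S], conjugating the splitting [t1] by [(h, s0)] gives [t2 + f]; hence [f]
   is a 1-cocycle, and it is divisible by [p^(x+m)]. *)
pose f g := t1 (bwd g) ^^ h + s0 + rho (bwd g) h - s0 ^^ g - t2 g - rho h g.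
have t1Q : {in Q &, forall g k,
    t1 (bwd g * bwd k)%g = t1 (bwd g) ^^ bwd k + t1 (bwd k) + rho (bwd g) (bwd k)}.
  by move=> g k /QP[a aE [<- _]] /QP[b bE [<- _]]; apply: t1M.
have t2Q : {in Q &, forall g k, t2 (g * k)%g = t2 g ^^ k + t2 k + rho g k}.
  by move=> g k /QP[a aE [_ <-]] /QP[b bE [_ <-]]; apply: t2M; apply: sE.
have fM : {in Q &, forall g k, f (g * k)%g = f g ^^ k + f k}.
  move=> g k gQ kQ; rewrite /f bwdM t1Q // t2Q // !(actTD, actTN).
  (* The claim is the cocycle identity at (bwd g, bwd k, h) plus that at (h, g, k) minus that at
     (bwd g, h, k). *)
  have := rhoA (bwd g) (bwd k) h; have := rhoA h g k; have := rhoA (bwd g) h k.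
  rewrite -[_ ^^ bwd k ^^ h]actTM -[_ ^^ h ^^ k]actTM -[_ ^^ g ^^ k]actTM !bwdh.
  move/eqP; rewrite -subr_eq0 => /eqP r3; move/eqP; rewrite -subr_eq0 => /eqP r2.
  move/eqP; rewrite -subr_eq0 => /eqP r1; apply/eqP; rewrite -subr_eq0; apply/eqP.
  have z0 : 0 = 0 + 0 - 0 :> T by rewrite subr0 addr0.
  by rewrite [RHS]z0 -{1}r1 -{1}r2 -r3; ring.
have cw a v : a \in E1 -> let b := cj a in
    glue x (a.1 * h)%g (t1 a.1 ^^ h + (s0 - v *+ p ^ x) + rho a.1 h)
      ((w1 a *+ p ^ m) ^^ h + v + c a.1 h *+ p ^ (2 * m)) =
    glue x (h * b.1)%g ((s0 - v *+ p ^ x) ^^ b.1 + t2 b.1 + rho h b.1)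
      (v ^^ b.1 + w2 b *+ p ^ m + c h b.1 *+ p ^ (2 * m)).
  move=> aE b; rewrite -!glueM -sglue -(ew1 a aE) -(ew2 b (sE a aE)).
  exact: cjE.
have [f' f'P] : {f' : P -> T & forall g, g \in Q -> f g = f' g *+ p ^ (x + m)}.
  apply: (choice (P := fun g t => g \in Q -> f g = t *+ p ^ (x + m))) => g.
  have [gQ|] := boolP (g \in Q); last by exists 0.
  have [a aE [a1 c1]] := QP _ gQ.
  (* Any preimage of s gives a congruence; the one with v = 0, solved for f g, has p^(x+m) in every
     term. *)
  have [z] := glue_eqmod (cw a 0 aE).
  rewrite c1 a1 mul0rn subr0 actT0 !add0r !addr0 actTMn => e.
  exists (w2 (cj a) + c h g *+ p ^ m - w1 a ^^ h - c (bwd g) h *+ p ^ m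
          + z *+ p ^ (2 * m).+1) => _.
  move: (w1 a) (w2 _) e => u1 u2.
  have -> : lvl x = ((2 * m).+1 + (x + m))%N by ring.
  move=> e; have -> : f g = z *+ p ^ ((2 * m).+1 + (x + m)) +
    (u2 *+ p ^ m + c h g *+ p ^ (2 * m) - (u1 ^^ h *+ p ^ m + c (bwd g) h *+ p ^ (2 * m))) *+ p ^ x.
    by rewrite -e /f; ring.
  by rewrite (expnD _ (2 * m).+1) (expnD _ x) mul2n -addnn expnD !mulrnA; ring.
have f'M : {in Q &, forall g k, f' (g * k)%g = f' g ^^ k + f' k}.
  move=> g k gQ kQ; apply: (@pMn_inj p d pp (x + m)).
  by rewrite /= mulrnDl -actTMn -!f'P ?groupM // fM.
(* Averaging costs p^m of the factor p^(x+m); the remaining p^x is the weight of the w-coordinate in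
   [glue]. *)
have [v vP] := cocycle1_split cardP f'M.
have fv g : g \in Q -> f g = (v - v ^^ g) *+ p ^ x.
  by move=> gQ; rewrite f'P // addnC expnD mulrnA vP.
exists (glue y h (s0 - v *+ p ^ x) v) => a aE /=; rewrite -/(cj a); set b := cj a.
apply/(conjX_eq _ _ _ (G y)).
have bE : b.1 \in Q.
  by rewrite mem_conjg conjgE invgK mulgA -[(_ * _)%g]cj1; apply: imset_f.
have e1 : (a.1 * h = h * b.1)%g by rewrite (cj1 a) bwdh.
have et : t1 a.1 ^^ h + (s0 - v *+ p ^ x) + rho a.1 h =
          (s0 - v *+ p ^ x) ^^ b.1 + t2 b.1 + rho h b.1.
  have := fv _ bE; rewrite /f -[bwd b.1]cj1 mulrnBl => e.
  rewrite actTB actTMn; apply/eqP; rewrite -subr_eq0; apply/eqP.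
  by rewrite -[RHS](subrr (v *+ p ^ x - v ^^ b.1 *+ p ^ x)) -{1}e; ring.
have := cw a v aE; rewrite !glueM -/b e1 et => /eq_glue e; exact/eq_glue.
Qed.

Lemma link_hom x y (E1 : {set Gr x}) (F1 : {set Gr y}) u1 v1 E2 F2 u2 v2 f :
  link E1 F1 u1 v1 -> link E2 F2 u2 v2 -> qhom (mul x) (inv x) E1 E2 f ->
  qhom (mul y) (inv y) F1 F2 (extend_id F1 (fun b => u2 (f (v1 b)))).
Proof.
case=> E1ob _ _ v1F [t1 [w1 [gl1 u1E]]] [_ _ u2E _ [t2 [w2 [gl2 u2w]]]] [s [sE ->]].
have [r rP] := conj_transfer y E1ob gl1 gl2 sE.
have rE b : b \in F1 -> conjX (mul y) (inv y) b r = u2 (conjX (mul x) (inv x) (v1 b) s).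
  move=> bF; have [vE uv] := v1F _ bF.
  by rewrite u2w ?sE // -rP // -u1E // uv.
exists r; split=> [b bF|]; first by rewrite rE //; case: (u2E _ (sE _ (proj1 (v1F _ bF)))).
by apply: eq_extend_id => b bF; rewrite rE // (proj1 (v1F _ bF)).
Qed.

Lemma tau_cat_equiv x y :
  cat_equiv (QuillenExt act (@tau x)) (QuillenExt act (@tau y)).
Proof.
apply: (link_cat_equiv (G x) (G y) (link := @link x y)).
- by move=> E F u v [].
- by move=> E /(link_ex y).
- move=> F /(link_ex x) [E [u [v L]]]; exists E, v, u; exact: link_sym.
- by move=> E1 F1 u1 v1 E2 F2 u2 v2 f L1 L2; apply: (link_hom L1 L2).
- by move=> E1 F1 u1 v1 E2 F2 u2 v2 g /link_sym L1 /link_sym L2; apply: (link_hom L1 L2).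
Qed.

End Family.

(** * The connecting homomorphism and the uniform shape of eta_x *)

Section Connecting.
Local Open Scope ring_scope.
Variables (p d : nat) (pp : prime p) (P : finGroupType) (act : V d -> P -> V d).
Hypothesis actP : lattice_action p act.
Local Notation T := (padic d pp).
Local Notation dT := (delta2 +%R -%R (actT (pp := pp) actP)).

Lemma cocycle2_padic (s : P -> P -> V d) : (forall g h, inT p (s g h)) ->
    cocycle2 (vadd p) (@v0 d) act s ->
  exists2 S : P -> P -> T, s = (fun g h => pv (S g h)) & cocycle2 +%R 0 (actT actP) S.
Proof.
move=> sT [s1 sA]; exists (fun g h => mkp pp (sT g h)) => //; split.
  by move=> g; split; apply: pv_inj; case: (s1 g).
by move=> g h k; apply: pv_inj; apply: sA.
Qed.

Lemma maps_to_class_padic x (c : P -> P -> M p d (x + ee p P)) z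
    (zT : forall g h k, inT p (z g h k)) : maps_to_class act c z <->
  exists C W : P -> P -> T,
    [/\ normalized2 0 C, forall g h, pr _ (C g h) = c g h, normalized2 0 W &
        forall g h k,
          dT C g h k = (mkp pp (zT g h k) + dT W g h k) *+ p ^ (x + ee p P)].
Proof.
split=> [[C [CT C1 Cc [W [WT W1 CW]]]]|[C [W [C1 Cc W1 CW]]]].
  exists (fun g h => mkp pp (CT g h)), (fun g h => mkp pp (WT g h)); split.
  - by move=> g; split; apply: pv_inj; case: (C1 g).
  - exact: Cc.
  - by move=> g; split; apply: pv_inj; case: (W1 g).
  - by move=> g h k; apply: pv_inj; rewrite pvMn; apply: CW.
exists (fun g h => pv (C g h)); split=> [g h|g|g h|].
- exact: pvP.
- by case: (C1 g) => -> ->.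
- exact: Cc.
exists (fun g h => pv (W g h)); split=> [g h|g|g h k].
- exact: pvP.
- by case: (W1 g) => -> ->.
- by have := congr1 (@pv _ _ _) (CW g h k); rewrite pvMn.
Qed.

(** If C lifts c, then p C lifts the image of c one level up. The extra p in its coboundary cancels
    against the division by one more power of p. *)
Lemma class_mul x (c : P -> P -> M p d (x + ee p P)) z :
    (forall g h k, inT p (z g h k)) -> maps_to_class act c z ->
  maps_to_class (x := x.+1) act (fun g h => mulM (c g h)) z.
Proof.
move=> zT /(maps_to_class_padic _ zT) [C [W [C1 Cc W1 CW]]].
apply/(maps_to_class_padic _ zT); exists (fun g h => C g h *+ p), W; split=> //.
- by move=> g; case: (C1 g) => -> ->; rewrite mul0rn.
- by move=> g h; rewrite -mulM_pr Cc.
move=> g h k; rewrite addSn expnSr mulrnA -CW /delta2 actTMn.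
by rewrite -!mulNrn -!mulrnDl.
Qed.

(** For lifts A and B, the coboundaries satisfy dA - dB = q (dV - dW), so A - B - q (V - W) is a
    cocycle over T that reduces to a - b. *)
Lemma class_inj x (a b : P -> P -> M p d (x + ee p P)) z :
    (forall g h k, inT p (z g h k)) ->
    maps_to_class act a z -> maps_to_class act b z ->
  I2M act (fun g h => a g h - b g h).
Proof.
move=> zT /(maps_to_class_padic _ zT) [A [V [A1 Aa V1 AV]]].
move=> /(maps_to_class_padic _ zT) [B [W [B1 Bb W1 BW]]].
set q := (p ^ (x + ee p P))%N in AV BW.
pose S g h := A g h - B g h - (V g h - W g h) *+ q.
exists (fun g h => pv (S g h)); split; [|split].
- by move=> g h; apply: pvP.
- have SZ : cocycle2 +%R 0 (actT actP) S.
    split=> [g|g h k].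
      rewrite /S; case: (A1 g) (B1 g) (V1 g) (W1 g) => -> -> [-> ->] [-> ->] [-> ->].
      by rewrite !subrr mul0rn subrr.
    have := AV g h k; have := BW g h k; rewrite /S /delta2 !(actTD, actTN, actTMn).
    move/eqP; rewrite -subr_eq0 => /eqP e1; move/eqP; rewrite -subr_eq0 => /eqP e2.
    apply/eqP; rewrite -subr_eq0; apply/eqP; rewrite -[RHS]subr0 -{1}e1 -e2; ring.
  split=> [g|g h k]; first by have [] := proj1 SZ g => -> ->.
  by have := congr1 (@pv _ _ _) (proj2 SZ g h k).
apply: funext => g; apply: funext => h; rewrite -[projM _ _ _ _]/(pr _ (S g h)).
rewrite /S raddfB /= [X in _ = _ - X](_ : _ = 0).
  by rewrite raddfB /= Aa Bb subr0.
by apply/pr_eq0; exists (V g h - W g h).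
Qed.

Variables (K : forall x, (P -> P -> M p d (x + ee p P)) -> Prop)
  (z : P -> P -> P -> V d) (eta : forall x, P -> P -> M p d (x + ee p P)).
Hypothesis KP : admissible_K act K.
Hypothesis zT : forall g h k, inT p (z g h k).
Hypothesis etaP : forall x, K (eta x) /\ maps_to_class act (eta x) z.

(** The difference of the two sides lies in K, and by [class_inj] in I^2; these meet only in 0. *)
Lemma eta_mul x : eta x.+1 = fun g h => mulM (eta x g h).
Proof.
have [Kx ex] := etaP x; have [KS eS] := etaP x.+1.
have [[_ _ KB] [K0 [_ [_ Kmul]]]] := KP x.+1; have [_ [_ [_ [_ KM]]]] := KP x.
have bK : K (x := x.+1) (fun g h => mulM (eta x g h)) by apply/KM; exists (eta x).
have e := K0 _ (KB _ _ KS bK) (class_inj zT eS (class_mul zT ex)).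
apply: funext => g; apply: funext => h; apply/eqP; rewrite -subr_eq0.
by have /= -> := congr1 (fun c => c g h) e.
Qed.

Lemma eta_uniform : exists c : P -> P -> T, forall x g h,
  eta x g h = pr (x + ee p P) (c g h *+ p ^ (2 * mP p P) *+ p ^ x).
Proof.
have [_ [_ [_ [KJ _]]]] := KP 0; have [s [_ [sJ e0]]] := KJ _ (proj1 (etaP 0)).
(* Membership in J^2 at x = 0 makes the values multiples of p^(e-m), and e - m = 2m. *)
have ex gh : exists t : T, eta 0 gh.1 gh.2 = pr (0 + ee p P) (t *+ p ^ (2 * mP p P)).
  have [u] := sJ gh.1 gh.2; rewrite e0 => ->; have [t ->] := prP pp u.
  by exists t; rewrite raddfMn /= /ee add0n (mulSn 2) addKn.
have [c cP] := choice ex; exists (fun g h => c (g, h)) => x g h.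
elim: x => [|x IH]; first by rewrite (cP (g, h)).
by rewrite eta_mul IH mulM_pr -mulrnA -expnSr.
Qed.

Lemma tauX_cocycle2 rho x :
    (forall g h, inT p (rho g h)) -> cocycle2 (vadd p) (@v0 d) act rho ->
  cocycle2 +%R 0 (@actM p d P act (x + ee p P)) (tauX rho eta x).
Proof.
move=> rhoT /(cocycle2_padic rhoT) [r -> [r1 rA]].
have [[KZ _ _] _] := KP x; have [e1 eA] := KZ _ (proj1 (etaP x)).
have tauE g h : tauX (fun g h => pv (r g h)) eta x g h = pr _ (r g h) + eta x g h by [].
split=> [g|g h k]; rewrite !tauE.
  by have [-> ->] := r1 g; have [-> ->] := e1 g; rewrite raddf0 addr0.
rewrite (actMD pp actP) (actM_pr actP) addrACA eA -raddfD rA raddfD.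
by rewrite addrACA.
Qed.

End Connecting.

Theorem theorem1p1 (p d : nat) (P : finGroupType) (act : V d -> P -> V d)
    (rho : P -> P -> V d)
    (K : forall x, (P -> P -> M p d (x + ee p P)) -> Prop)
    (z : P -> P -> P -> V d)
    (eta : forall x, P -> P -> M p d (x + ee p P)) :
  prime p -> (p.-group [set: P])%g ->
  setting p act rho ->
  admissible_K act K ->
  (forall g h k, inT p (z g h k)) -> cocycle3 (vadd p) (vopp p) (@v0 d) act z ->
  (forall x, K x (eta x) /\ maps_to_class act (eta x) z) ->
  exists x0 : nat, forall x y, x0 <= x -> x0 <= y ->
    cat_equiv (QuillenExt act (tauX rho eta x)) (QuillenExt act (tauX rho eta y)).
Proof.
move=> pp Pp [actP [[rhoT rhoZ] _]] KP zT _ etaP; exists 1.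
have [c cE] := eta_uniform pp actP KP zT etaP.
have [r rE [_ rA]] := cocycle2_padic pp actP rhoT rhoZ.
have cardP := card_pgroup Pp.
(* One factor p of p^(x+1) moves into c, so that [tau] at x is the cocycle of G_(x+1) with weight
   p^x, the p-torsion of its module then coming from p^(x+3m) T. *)
pose c' g h := (c g h *+ p)%R.
have tauE x : tauX rho eta x.+1 = @tau p d pp P (mP p P) r c' x.
  apply: funext => g; apply: funext => h.
  rewrite /tauX cE rE -[projM _ _ _ _]/(pr _ (r g h)) -raddfD /=.
  by rewrite /tau /c' -!mulrnA expnS mulnCA.
have tauZ x : cocycle2 +%R 0%R (@actM p d P act (x + 3 * mP p P).+1) (@tau p d pp P (mP p P) r c' x).
  by rewrite -tauE; exact: (tauX_cocycle2 pp actP KP etaP x.+1 rhoT rhoZ).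
case=> // x [//|y] _ _; rewrite !tauE.
exact: (tau_cat_equiv cardP rA tauZ).
Qed.
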